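(* Let $q$ be an even prime power and let $L$ be a line of $\mathrm{PG}(5,q)$ in the $K$-orbit $o_{8,3}$. Then the hyperplane-orbit distribution of $L$ is $OD_4(L)=[q+1,\,q^2+q,\,0,\,q^3-q]$.
   Context: A point $(y_0,\dots,y_5)$ of $\mathrm{PG}(5,q)$ is identified with the nonzero symmetric matrix $\begin{bmatrix} y_0&y_1&y_2\\ y_1&y_3&y_4\\ y_2&y_4&y_5\end{bmatrix}$ up to scalar. $K\cong\mathrm{PGL}(3,q)$ acts by $M\mapsto AMA^T$, $A\in\mathrm{GL}(3,q)$. The orbit $o_{8,3}$ (defined only for $q$ even) is the $K$-orbit of the line $\left\{\begin{bmatrix}x&0&0\\0&0&y\\0&y&0\end{bmatrix}:(x,y)\in\mathrm{PG}(1,q)\right\}$. Hyperplanes correspond to conics of $\mathrm{PG}(2,q)$ (nonzero quadratic forms up to scalar): $\sum_{0\le i\le j\le2}a_{ij}X_iX_j$ corresponds to $a_{00}Y_0+a_{01}Y_1+a_{02}Y_2+a_{11}Y_3+a_{12}Y_4+a_{22}Y_5=0$. $\mathcal H_1,\mathcal H_{2,r},\mathcal H_{2,i},\mathcal H_3$ are the sets of hyperplanes corresponding respectively to double lines (scalar multiples of squares of linear forms), pairs of distinct real lines (products of two non-proportional linear forms over $\mathbb F_q$), pairs of conjugate imaginary lines (scalar multiples of products of two non-proportional linear forms conjugate over $\mathbb F_{q^2}$), and non-singular conics (those with $4a_{00}a_{11}a_{22}+a_{01}a_{02}a_{12}-a_{00}a_{12}^2-a_{11}a_{02}^2-a_{22}a_{01}^2\ne0$).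 $OD_4(L)=[h_1,h_{2,r},h_{2,i},h_3]$ lists the numbers of hyperplanes in $\mathcal H_1,\mathcal H_{2,r},\mathcal H_{2,i},\mathcal H_3$ containing $L$. *)

(* Defs.v *)
From HB Require Import structures.
From mathcomp Require Import all_boot all_order all_algebra.
From mathcomp Require Import mpoly.

Set Implicit Arguments.
Unset Strict Implicit.
Unset Printing Implicit Defensive.

Import GRing.Theory.
Local Open Scope ring_scope.

Section PG5.

Variable F : finFieldType.

(* A point of PG(5,q) is the set of nonzero multiples of a nonzero symmetric
   matrix; lines and hyperplanes are sets of points. *)
Definition point (M : 'M[F]_3) : {set 'M[F]_3} :=
  [set c *: M | c : F & c != 0].

Definition PG5 : {set {set 'M[F]_3}} :=
  [set point M | M : 'M[F]_3 & (M^T == M) && (M != 0)].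

Definition actK (A : 'M[F]_3) (L : {set {set 'M[F]_3}}) :
    {set {set 'M[F]_3}} :=
  [set [set A *m M *m A^T | M in P : {set 'M[F]_3}] | P in L].

Definition o83_mx (x y : F) : 'M[F]_3 :=
  \matrix_(i, j) (if (i == 0) && (j == 0) then x
                  else if (i + j == 3)%N then y else 0).

Definition o83_line : {set {set 'M[F]_3}} :=
  [set point (o83_mx p.1 p.2) | p : F * F & p != (0, 0)].

Definition o83 : {set {set {set 'M[F]_3}}} :=
  [set actK A o83_line | A : 'M[F]_3 & A \in unitmx].

(* Only the entries a i j with i <= j of a coefficient matrix are ever read.
   Distinct matrices may give the same hyperplane, which is a set of points
   and is therefore counted once. *)
Definition hyperplane (a : 'M[F]_3) : {set {set 'M[F]_3}} :=
  [set P in PG5 | [forall M in P,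
    \sum_(i < 3) \sum_(j < 3 | (i <= j)%N) a i j * M i j == 0]].

End PG5.

Section Forms.

Variable R : comNzRingType.

Definition linform (u : 'rV[R]_3) : {mpoly R[3]} := \sum_(i < 3) u 0 i *: 'X_i.

Definition quadform (a : 'M[R]_3) : {mpoly R[3]} :=
  \sum_(i < 3) \sum_(j < 3 | (i <= j)%N) a i j *: ('X_i * 'X_j).

Definition disc (a : 'M[R]_3) : R :=
  4%:R * a 0 0 * a 1 1 * a 2 2 + a 0 1 * a 0 2 * a 1 2
  - a 0 0 * a 1 2 ^+ 2 - a 1 1 * a 0 2 ^+ 2 - a 2 2 * a 0 1 ^+ 2.

End Forms.

Section OrbitDistribution.

(* E is a model of the quadratic extension of F, embedded by iota. *)
Variables (F E : finFieldType) (iota : {rmorphism F -> E}).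

Definition conjq (u : 'rV[E]_3) : 'rV[E]_3 :=
  map_mx (fun x => x ^+ #|F|) u.

Definition nonprop (K : fieldType) (u v : 'rV[K]_3) : bool :=
  row_free (col_mx u v).

Definition double_line (f : {mpoly F[3]}) : bool :=
  (f != 0) && [exists c : F, exists u : 'rV[F]_3, f == c *: linform u ^+ 2].

Definition real_pair (f : {mpoly F[3]}) : bool :=
  [exists u : 'rV[F]_3, exists v : 'rV[F]_3,
    nonprop u v && (f == linform u * linform v)].

Definition imaginary_pair (f : {mpoly F[3]}) : bool :=
  (f != 0) && [exists c : F, exists u : 'rV[E]_3,
    nonprop u (conjq u) &&
    (map_mpoly iota f == iota c *: (linform u * linform (conjq u)))].

Definition H1 : {set {set {set 'M[F]_3}}} :=
  [set hyperplane a | a : 'M[F]_3 & double_line (quadform a)].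

Definition H2r : {set {set {set 'M[F]_3}}} :=
  [set hyperplane a | a : 'M[F]_3 & real_pair (quadform a)].

Definition H2i : {set {set {set 'M[F]_3}}} :=
  [set hyperplane a | a : 'M[F]_3 & imaginary_pair (quadform a)].

Definition H3 : {set {set {set 'M[F]_3}}} :=
  [set hyperplane a | a : 'M[F]_3 & disc a != 0].

Definition OD4 (L : {set {set 'M[F]_3}}) : seq nat :=
  [seq #|[set H in X : {set {set {set 'M[F]_3}}} | L \subset H]|
  | X <- [:: H1; H2r; H2i; H3]].

End OrbitDistribution.

(* Main.v *)
(* A hyperplane contains the line A . L0 iff the quadratic form f it stands for
   is such that g = f o A has the shape
     x X0X1 + y X0X2 + z X1^2 + w X2^2,
   where L0 is the representative of the orbit.  In characteristic 2, g is a
   square when x = y = 0; its discriminant is z y^2 + w x^2; and when this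
   vanishes with (x, y) <> 0 we have (z, w) = s (x^2, y^2) and
   g = (x X1 + y X2) (X0 + s (x X1 + y X2)).  So imaginary pairs never occur, and
   the other types are counted by (q^2 - 1), (q^2 - 1) q and q^4 - q^3 - q^2 + q
   quadruples, each hyperplane arising from q - 1 of them. *)

Require Import Defs.
From HB Require Import structures.
From mathcomp Require Import all_boot all_order all_algebra.
From mathcomp Require Import finfield.
From mathcomp Require Import mpoly.
From mathcomp Require Import ring zify.

Set Implicit Arguments.
Unset Strict Implicit.
Unset Printing Implicit Defensive.

Import GRing.Theory.
Local Open Scope ring_scope.

(** * Coefficient matrices of ternary quadratic forms, and linear substitution in them *)

Section Coefficients.

Variable R : comNzRingType.
Implicit Types (a b B M A : 'M[R]_3) (u v : 'rV[R]_3).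

Definition pairing a M : R := \sum_(i < 3) \sum_(j < 3 | (i <= j)%N) a i j * M i j.

(** Normal form of a coefficient matrix: two matrices give the same form exactly when their [upper]
    parts agree. *)
Definition upper a : 'M[R]_3 := \matrix_(i, j) (if (i <= j)%N then a i j else 0).

(** The upper triangular coefficients of the form with arbitrary square matrix [B]: the entries at
    (i, j) and (j, i) both contribute to the coefficient of X_i X_j. *)
Definition fold B : 'M[R]_3 := \matrix_(i, j)
  (if (i < j)%N then B i j + B j i else if i == j then B i i else 0).

(* The upper triangular coefficients of the form v |-> f(A v), where f has
   coefficients a. *)
Definition subst A a : 'M[R]_3 := fold (A^T *m upper a *m A).

Lemma ord3P (P : 'I_3 -> Prop) : P 0 -> P 1 -> P (2%:R) -> forall i, P i.
Proof.
move=> P0 P1 P2 [[|[|[|//]]] Hi].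
- by rewrite (_ : Ordinal Hi = 0) //; apply: val_inj.
- by rewrite (_ : Ordinal Hi = 1) //; apply: val_inj.
- by rewrite (_ : Ordinal Hi = 2%:R) //; apply: val_inj.
Qed.

Lemma sum3 (V : nmodType) (f : 'I_3 -> V) : \sum_(i < 3) f i = f 0 + f 1 + f 2%:R.
Proof.
rewrite !big_ord_recr big_ord0 /= add0r.
by congr (f _ + f _ + f _); apply: val_inj.
Qed.

Lemma sum_upper (V : nmodType) (f : 'I_3 -> 'I_3 -> V) :
  \sum_(i < 3) \sum_(j < 3 | (i <= j)%N) f i j =
  f 0 0 + f 0 1 + f 0 2%:R + (f 1 1 + f 1 2%:R) + f 2%:R 2%:R.
Proof.
under eq_bigr => i _ do rewrite big_mkcond sum3.
by rewrite sum3 /= !add0r.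
Qed.

Lemma pairing_tr a M : M^T = M -> pairing a M = \tr (upper a *m M).
Proof.
move=> /matrixP sM; rewrite /pairing /mxtrace; apply: eq_bigr => i _.
rewrite mxE big_mkcond; apply: eq_bigr => j _; rewrite mxE.
by case: ifP => _; rewrite ?mul0r // -[in RHS]sM mxE.
Qed.

Lemma pairing_fold B M : M^T = M -> pairing (fold B) M = \tr (B *m M).
Proof.
move=> /matrixP sM.
have sE i j : M i j = M j i by rewrite -[in LHS]sM mxE.
rewrite /pairing /mxtrace sum_upper sum3 !mxE !sum3 /=.
rewrite (sE 1 0) (sE 2%:R 0) (sE 2%:R 1); ring.
Qed.

Lemma upper_fold B : upper (fold B) = fold B.
Proof.
apply/matrixP => i j; rewrite !mxE; case: ltngtP => //.
by move=> ij; case: eqP ij => // ->; rewrite ltnn.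
Qed.

Lemma upper_id a : upper (upper a) = upper a.
Proof. by apply/matrixP => i j; rewrite !mxE; case: leqP. Qed.

(** The entry at (i, j) is read off by pairing with the symmetric 0-1 matrix supported on (i, j) and
    (j, i). The disjunction gives it the entry 1, not 2, when i = j, so no division by 2 occurs. *)
Lemma pairing_inj a b : (forall M, M^T = M -> pairing a M = pairing b M) ->
  upper a = upper b.
Proof.
move=> eq_ab.
have eq_f (f : nat -> nat -> bool) : (forall k l, f k l = f l k) ->
    pairing a (\matrix_(k, l) (f k l)%:R) = pairing b (\matrix_(k, l) (f k l)%:R).
  by move=> sf; apply: eq_ab; apply/matrixP => k l; rewrite !mxE sf.
apply/matrixP => i j; rewrite !mxE; case: leqP => // le_ij.
have := eq_f (fun k l => ((k == i) && (l == j)) || ((l == i) && (k == j)))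
             (fun k l => orbC _ _).
rewrite /pairing !sum_upper !mxE.
by elim/ord3P: i le_ij; elim/ord3P: j => // _; rewrite /= ?mulr0 ?mulr1 ?add0r ?addr0.
Qed.

Lemma subst_upper A a : subst A (upper a) = subst A a.
Proof. by rewrite /subst upper_id. Qed.

Lemma upper_subst A a : upper (subst A a) = subst A a.
Proof. exact: upper_fold. Qed.

(** Substitution in forms is dual to the action of K on symmetric matrices; this is cyclicity of the
    trace. *)
Lemma pairing_subst A a M : M^T = M -> pairing (subst A a) M = pairing a (A *m M *m A^T).
Proof.
move=> sM; rewrite pairing_fold // pairing_tr; last by rewrite !trmx_mul trmxK sM mulmxA.
by rewrite -!mulmxA mxtrace_mulC !mulmxA.
Qed.

Lemma congr_sym A M : M^T = M -> (A *m M *m A^T)^T = A *m M *m A^T.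
Proof. by move=> sM; rewrite !trmx_mul trmxK sM mulmxA. Qed.

(** By duality: both sides are upper triangular, so it suffices that they pair equally with every
    symmetric matrix. *)
Lemma subst_fold A B : subst A (fold B) = fold (A^T *m B *m A).
Proof.
rewrite -upper_subst -[RHS]upper_fold; apply: pairing_inj => M sM.
rewrite pairing_subst // !pairing_fold ?congr_sym //.
by rewrite -(mulmxA _ A M) -(mulmxA A^T) [RHS]mxtrace_mulC !mulmxA.
Qed.

Lemma substM A A' a : subst A (subst A' a) = subst (A' *m A) a.
Proof. by rewrite subst_fold /subst trmx_mul !mulmxA. Qed.

Lemma fold_upper a : fold (upper a) = upper a.
Proof.
apply/matrixP => i j; rewrite !mxE.
by elim/ord3P: i; elim/ord3P: j; rewrite /= ?addr0.
Qed.

Lemma subst1 a : subst 1%:M a = upper a.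
Proof. by rewrite /subst trmx1 mul1mx mulmx1 fold_upper. Qed.

Lemma foldZ c B : fold (c *: B) = c *: fold B.
Proof.
by apply/matrixP => i j; rewrite !mxE; do 2?[case: ifP => _]; rewrite ?mulr0 ?mulrDr.
Qed.

Lemma upperZ c a : upper (c *: a) = c *: upper a.
Proof. by apply/matrixP => i j; rewrite !mxE; case: ifP; rewrite ?mulr0. Qed.

Lemma upper0 : upper 0 = 0.
Proof. by have := upperZ 0 0; rewrite !scale0r. Qed.

Lemma substZ A c a : subst A (c *: a) = c *: subst A a.
Proof. by rewrite /subst upperZ -scalemxAr -scalemxAl foldZ. Qed.

Lemma subst0 A : subst A 0 = 0.
Proof. by have := substZ A 0 0; rewrite !scale0r. Qed.

Lemma pairingZ c a M : pairing (c *: a) M = c * pairing a M.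
Proof. by rewrite /pairing !sum_upper !mxE; ring. Qed.

Lemma pairing_upper a M : pairing (upper a) M = pairing a M.
Proof. by rewrite /pairing !sum_upper !mxE. Qed.

Lemma quadform_upper a : quadform (upper a) = quadform a.
Proof. by rewrite /quadform !sum_upper !mxE. Qed.

(** Evaluation at the unit vectors e_i gives the diagonal coefficients; evaluation at e_i + e_j then
    gives the mixed ones, in any characteristic. *)
Lemma quadform_eq a b : quadform a = quadform b <-> upper a = upper b.
Proof.
split=> [eq_ab|eq_ab]; last by rewrite -quadform_upper eq_ab quadform_upper.
have eval f c : (quadform c).@[f] =
    \sum_(i < 3) \sum_(j < 3 | (i <= j)%N) c i j * (f i * f j).
  by rewrite /quadform !sum_upper !mevalD !mevalZ !mevalM !mevalXU.
have eq_f f : (quadform a).@[f] = (quadform b).@[f] by rewrite eq_ab.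
have diag i : a i i = b i i.
  have := eq_f (fun k => (k == i)%:R); rewrite !eval !sum_upper.
  by elim/ord3P: i; rewrite /= ?(mulr0, mul0r, mulr1, add0r, addr0).
apply/matrixP => i j; rewrite !mxE; case: leqP => // le_ij.
have := eq_f (fun k => ((k == i) || (k == j))%:R); rewrite !eval !sum_upper.
elim/ord3P: i le_ij; elim/ord3P: j => // _;
  rewrite /= ?(mulr0, mul0r, mulr1, add0r, addr0) ?diag //.
- by move/addIr/addrI.
- by move/addIr/addrI.
- by move/addIr/addrI.
Qed.

Lemma linform_mul u v : linform u * linform v = quadform (fold (u^T *m v)).
Proof.
rewrite /linform /quadform sum_upper !sum3 !mxE /= !big_ord1 !mxE.
rewrite -!mul_mpolyC !mpolyCD !mpolyCM; ring.
Qed.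

Lemma quadformZ c a : quadform (c *: a) = c *: quadform a.
Proof.
by rewrite /quadform !sum_upper !mxE !scalerDr !scalerA.
Qed.

Lemma quadform0 : quadform (0 : 'M[R]_3) = 0.
Proof. by have := quadformZ 0 0; rewrite !scale0r. Qed.

Lemma disc_upper a : disc (upper a) = disc a.
Proof. by rewrite /disc !mxE. Qed.

Lemma disc_fold_mul u v : disc (fold (u^T *m v)) = 0.
Proof. rewrite /disc !mxE /= !big_ord1 !mxE; ring. Qed.

Lemma discZ c a : disc (c *: a) = c ^+ 3 * disc a.
Proof. rewrite /disc !mxE; ring. Qed.

Lemma det3 A : \det A =
  A 0 0 * (A 1 1 * A 2%:R 2%:R - A 1 2%:R * A 2%:R 1)
  - A 0 1 * (A 1 0 * A 2%:R 2%:R - A 1 2%:R * A 2%:R 0)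
  + A 0 2%:R * (A 1 0 * A 2%:R 1 - A 1 1 * A 2%:R 0).
Proof.
(* Indexing by natural numbers lets the lifted ordinals of the cofactor expansions compute. *)
pose f k l := A (inord k) (inord l).
have fE i j : A i j = f i j by rewrite /f !inord_val.
rewrite (expand_det_row _ 0) sum3 /cofactor !(expand_det_row _ ord0).
rewrite !big_ord_recl !big_ord0 /cofactor !det_mx11 !mxE !fE /=; ring.
Qed.

(** Multiplicativity of the determinant only yields twice this identity, which is void in
    characteristic 2; hence the direct expansion. *)
Lemma disc_subst A a : disc (subst A a) = \det A ^+ 2 * disc a.
Proof.
rewrite det3 /disc !mxE /=.
rewrite !sum3 !mxE !sum3 !mxE /=.
ring.
Qed.

End Coefficients.

(** * Non-proportionality of linear forms through 2 x 2 minors *)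

Section Minors.

Variable K : fieldType.
Implicit Types u v : 'rV[K]_3.

Lemma nonpropP u v :
  reflect (exists i j, u 0 i * v 0 j != u 0 j * v 0 i) (nonprop u v).
Proof.
apply: (iffP idP) => [free_uv|[i [j ne_ij]]].
  case: (boolP [exists i, [exists j, u 0 i * v 0 j != u 0 j * v 0 i]]) =>
    [/existsP[i /existsP[j ?]]|/existsPn minor0]; first by exists i, j.
  have {}minor0 i j : u 0 i * v 0 j = u 0 j * v 0 i.
    by have /existsPn/(_ j)/negPn/eqP := minor0 i.
  have /row_free_inj inj_uv := free_uv.
  have [u0|/rV0Pn[k uk]] := eqVneq u 0.
    have := inj_uv 1 (row_mx 1%:M 0) 0.
    rewrite mul_row_col mul1mx mul0mx addr0 mul0mx => /(_ u0)/matrixP/(_ 0 (lshift 1 0)).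
    by rewrite row_mxEl !mxE eqxx => /eqP; rewrite oner_eq0.
  (* If all minors vanish, then v_k u - u_k v = 0 is a linear relation, nontrivial because u_k is
     nonzero. *)
  have := inj_uv 1 (row_mx (v 0 k)%:M (- u 0 k)%:M) 0.
  rewrite mul_row_col !mul_scalar_mx mul0mx.
  have -> : v 0 k *: u + - u 0 k *: v = 0.
    by apply/rowP => j; rewrite !mxE mulNr minor0 [v 0 k * _]mulrC subrr.
  move=> /(_ erefl)/matrixP/(_ 0 (rshift 1 0)).
  by rewrite row_mxEr !mxE eqxx mulr1n => /eqP; rewrite oppr_eq0 (negPf uk).
apply: inj_row_free => w; rewrite -[w]hsubmxK mul_row_col.
move: (lsubmx w) (rsubmx w) => s t /rowP st0.
have eq0 k : s 0 0 * u 0 k + t 0 0 * v 0 k = 0.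
  by have := st0 k; rewrite !mxE !big_ord1.
have det_neq0 : u 0 i * v 0 j - u 0 j * v 0 i != 0 by rewrite subr_eq0.
have s0 : s 0 0 = 0.
  apply: (mulIf det_neq0); rewrite mul0r.
  have -> : s 0 0 * (u 0 i * v 0 j - u 0 j * v 0 i) =
    (s 0 0 * u 0 i + t 0 0 * v 0 i) * v 0 j - (s 0 0 * u 0 j + t 0 0 * v 0 j) * v 0 i by ring.
  by rewrite !eq0 !mul0r subrr.
have t0 : t 0 0 = 0.
  apply: (mulIf det_neq0); rewrite mul0r.
  have -> : t 0 0 * (u 0 i * v 0 j - u 0 j * v 0 i) =
    (s 0 0 * u 0 j + t 0 0 * v 0 j) * u 0 i - (s 0 0 * u 0 i + t 0 0 * v 0 i) * u 0 j by ring.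
  by rewrite !eq0 !mul0r subrr.
by rewrite [s]mx11_scalar [t]mx11_scalar s0 t0 !raddf0 row_mx0.
Qed.

Lemma nonpropM u v (A : 'M[K]_3) : A \in unitmx ->
  nonprop (u *m A) (v *m A) = nonprop u v.
Proof.
by move=> A_unit; rewrite /nonprop -mul_col_mx /row_free mxrankMfree ?row_free_unit.
Qed.

(** If the product of the two linear forms had only zero coefficients, every u_k v_l would have
    square zero, and so would every minor vanish. *)
Lemma fold_nonprop_neq0 u v : nonprop u v -> fold (u^T *m v) != 0.
Proof.
move=> /nonpropP[i [j ne_ij]]; apply: contra_neq ne_ij => /matrixP fold0.
have diag k : u 0 k * v 0 k = 0.
  by have := fold0 k k; rewrite !mxE ltnn eqxx big_ord1 !mxE.
have lt0 (k l : 'I_3) : (k < l)%N -> u 0 k * v 0 l + u 0 l * v 0 k = 0.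
  by move=> kl; have := fold0 k l; rewrite !mxE kl !big_ord1 !mxE.
have {}lt0 k l : u 0 k * v 0 l + u 0 l * v 0 k = 0.
  case: (ltngtP k l) => [|/lt0|/val_inj->]; [exact: lt0 | by rewrite addrC |].
  by rewrite diag addr0.
have mul0 k l : u 0 k * v 0 l = 0.
  apply/eqP; rewrite -sqrf_eq0; apply/eqP.
  have -> : (u 0 k * v 0 l) ^+ 2 =
    u 0 k * v 0 l * (u 0 k * v 0 l + u 0 l * v 0 k) - u 0 k * v 0 k * (u 0 l * v 0 l) by ring.
  by rewrite lt0 !diag !mulr0 subrr.
by rewrite !mul0.
Qed.

End Minors.

(** * Double lines and real line pairs in terms of coefficients, and their invariance under
    substitution and scaling *)

Section ConicTypes.

Variable F : finFieldType.
Implicit Types (a b A : 'M[F]_3) (u v : 'rV[F]_3).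

Lemma quadform_neq0 a : (quadform a != 0) = (upper a != 0).
Proof.
congr (~~ _); apply/eqP/eqP => [a0|a0].
  by rewrite -upper0; apply/quadform_eq; rewrite quadform0.
by rewrite -quadform0; apply/quadform_eq; rewrite upper0.
Qed.

Lemma quadform_factor (K : finFieldType) (a : 'M[K]_3) c (u v : 'rV[K]_3) :
  quadform a = c *: (linform u * linform v) <-> upper a = c *: fold (u^T *m v).
Proof.
by rewrite linform_mul -quadformZ quadform_eq upperZ upper_fold.
Qed.

Lemma double_lineP a :
  reflect (upper a != 0 /\ exists c u, upper a = c *: fold (u^T *m u))
          (double_line (quadform a)).
Proof.
rewrite /double_line quadform_neq0; apply: (iffP andP) => -[a0].
  move=> /existsP[c /existsP[u /eqP]]; rewrite expr2 => /quadform_factor e.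
  by split=> //; exists c, u.
move=> [c [u /quadform_factor e]]; split=> //.
by apply/existsP; exists c; apply/existsP; exists u; rewrite e expr2.
Qed.

Lemma real_pairP a :
  reflect (exists u v, nonprop u v /\ upper a = fold (u^T *m v))
          (real_pair (quadform a)).
Proof.
apply: (iffP existsP) => -[u].
  move=> /existsP[v /andP[uv /eqP e]]; exists u, v; split=> //.
  by rewrite -[RHS]scale1r; apply/quadform_factor; rewrite scale1r.
move=> [v [uv e]]; exists u; apply/existsP; exists v; rewrite uv /=.
by apply/eqP; rewrite -[RHS]scale1r; apply/quadform_factor; rewrite scale1r.
Qed.

Lemma subst_factor A a c u v : upper a = c *: fold (u^T *m v) ->
  subst A a = c *: fold ((u *m A)^T *m (v *m A)).
Proof.
by move=> e; rewrite -subst_upper e substZ subst_fold trmx_mul !mulmxA.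
Qed.

Lemma subst_neq0 A a : A \in unitmx -> upper a != 0 -> subst A a != 0.
Proof.
move=> A_unit; apply: contra_neq => e.
by rewrite -subst1 -(mulmxV A_unit) -substM e subst0.
Qed.

Lemma double_line_subst A a : A \in unitmx ->
  double_line (quadform a) -> double_line (quadform (subst A a)).
Proof.
move=> A_unit /double_lineP[a0 [c [u e]]]; apply/double_lineP.
by rewrite upper_subst subst_neq0 //; split=> //; exists c, (u *m A); apply: subst_factor.
Qed.

Lemma double_lineZ c a : c != 0 ->
  double_line (quadform a) -> double_line (quadform (c *: a)).
Proof.
move=> c0 /double_lineP[a0 [d [u e]]]; apply/double_lineP.
rewrite upperZ scaler_eq0 negb_or c0; split=> //.
by exists (c * d), u; rewrite e scalerA.
Qed.

Lemma real_pair_neq0 a : real_pair (quadform a) -> upper a != 0.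
Proof. by move=> /real_pairP[u [v [uv ->]]]; apply: fold_nonprop_neq0. Qed.

Lemma real_pair_subst A a : A \in unitmx ->
  real_pair (quadform a) -> real_pair (quadform (subst A a)).
Proof.
move=> A_unit /real_pairP[u [v [uv e]]]; apply/real_pairP.
exists (u *m A), (v *m A); rewrite nonpropM // upper_subst; split=> //.
by rewrite -[RHS]scale1r; apply: subst_factor; rewrite scale1r.
Qed.

(** The definition of a real pair carries no scalar, so [c] is absorbed into the first factor. *)
Lemma real_pairZ c a : c != 0 ->
  real_pair (quadform a) -> real_pair (quadform (c *: a)).
Proof.
move=> c0 /real_pairP[u [v [/nonpropP[i [j ne_ij]] e]]]; apply/real_pairP.
exists (c *: u), v; split.
  by apply/nonpropP; exists i, j; rewrite !mxE -!mulrA (inj_eq (mulfI c0)).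
by rewrite upperZ e -foldZ linearZ scalemxAl.
Qed.

Lemma disc_neq0 a : disc a != 0 -> upper a != 0.
Proof.
apply: contra_neq => a0; rewrite -disc_upper a0.
by have := discZ 0 (0 : 'M[F]_3); rewrite scale0r expr0n mul0r.
Qed.

Lemma real_pair_disc a : real_pair (quadform a) -> disc a = 0.
Proof. by move=> /real_pairP[u [v [_ e]]]; rewrite -disc_upper e disc_fold_mul. Qed.

End ConicTypes.

(** * Conjugate imaginary line pairs *)

Section Imaginary.

Variables (F E : finFieldType) (iota : {rmorphism F -> E}).

Lemma map_quadform (a : 'M[F]_3) :
  map_mpoly iota (quadform a) = quadform (map_mx iota a).
Proof.
by rewrite /quadform !sum_upper !raddfD /= !map_mpolyZ !rmorphM /= !map_mpolyX !mxE.
Qed.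

Lemma map_disc (a : 'M[F]_3) : disc (map_mx iota a) = iota (disc a).
Proof. by rewrite /disc !mxE 3!rmorphB rmorphD !(rmorphXn, rmorphM) rmorph_nat. Qed.

Lemma upper_map (a : 'M[F]_3) : upper (map_mx iota a) = map_mx iota (upper a).
Proof. by apply/matrixP => i j; rewrite !mxE; case: ifP; rewrite ?rmorph0. Qed.

Lemma linform_eval (K : comNzRingType) (u v : 'rV[K]_3) :
  (linform u).@[v 0] = (u *m v^T) 0 0.
Proof.
rewrite /linform raddf_sum /= mxE; apply: eq_bigr => i _.
by rewrite mevalZ mevalXU mxE.
Qed.

(** The power map with exponent [#|F|] is additive on [E], as [#|F|] is a power of the
    characteristic, and it fixes the image of [F]. So at a rational vector the conjugate form takes
    the conjugate value. *)
Lemma frobenius_conjq (u : 'rV[E]_3) (v : 'rV[F]_3) :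
  (conjq F u *m (map_mx iota v)^T) 0 0 = ((u *m (map_mx iota v)^T) 0 0) ^+ #|F|.
Proof.
have [p _ charF] := finPcharP F.
have charE : p \in [pchar E] by rewrite (fmorph_pchar iota).
have F_nat : [pchar E].-nat #|F|.
  rewrite (card_pprimeChar charF) pnatX; apply/orP; left.
  by rewrite pnatE ?(pcharf_prime charF).
rewrite !mxE !sum3 !(exprDn_pchar _ _ F_nat) !mxE !exprMn.
by rewrite -!rmorphXn !expf_card.
Qed.

(* The F-rational zeros of an imaginary pair lie on both conjugate lines, so
   they span at most one point, whereas a form with a rational linear factor
   vanishes on a rational plane of vectors. *)
Lemma imaginary_pair_not_split (a : 'M[F]_3) c (w1 w2 : 'rV[F]_3) :
  imaginary_pair iota (quadform a) -> upper a != c *: fold (w1^T *m w2).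
Proof.
move=> /andP[a0 /existsP[d /existsP[u /andP[free_u /eqP e]]]].
apply/eqP => /quadform_factor e_a.
have d0 : d != 0.
  apply: contra_neq a0 => d0; move: e; rewrite d0 rmorph0 scale0r map_quadform => e.
  apply/eqP; rewrite -[_ == _]negbK quadform_neq0 negbK.
  have : upper (map_mx iota a) == 0 by rewrite -[_ == _]negbK -quadform_neq0 e eqxx.
  rewrite upper_map => /eqP/matrixP e0; apply/eqP/matrixP => i j.
  by have := e0 i j; rewrite !mxE => /eqP; rewrite fmorph_eq0 => /eqP.
(* The rows of [N] span the rational vectors on which the factor [w1] vanishes, a space of dimension
   at least 2. *)
pose N := kermx w1^T.
have zero i : (u *m (map_mx iota (row i N))^T) 0 0 = 0.
  have w1N : (w1 *m (row i N)^T) = 0.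
    by rewrite -[LHS]trmxK trmx_mul trmxK -row_mul mulmx_ker row0 trmx0.
  have lin_map w : map_mpoly iota (linform w) = linform (map_mx iota w).
    rewrite /linform raddf_sum; apply: eq_bigr => k _ /=.
    by rewrite map_mpolyZ map_mpolyX mxE.
  have : (map_mpoly iota (quadform a)).@[(map_mx iota (row i N)) 0] = 0.
    rewrite e_a map_mpolyZ rmorphM /= !lin_map mevalZ mevalM linform_eval.
    by rewrite map_trmx -map_mxM w1N !mxE rmorph0 mul0r mulr0.
  (* At such a vector the form equals d times the (q+1)-st power of the value of [u], where q is
     [#|F|], so [u] vanishes there. *)
  rewrite e mevalZ mevalM !linform_eval frobenius_conjq -exprS => /eqP.
  by rewrite mulf_eq0 fmorph_eq0 (negPf d0) expf_eq0 => /eqP.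
have /mulmx0_rank_max : map_mx iota N *m (col_mx u (conjq F u))^T = 0.
  have zero' (w : 'rV[E]_3) : (forall i, (w *m (map_mx iota (row i N))^T) 0 0 = 0) ->
      map_mx iota N *m w^T = 0.
    move=> w0; apply/matrixP => i j; rewrite [j]ord1 [RHS]mxE -(w0 i).
    rewrite map_row -[_ *m _ in RHS]trmxK trmx_mul trmxK -row_mul.
    by rewrite !mxE.
  rewrite tr_col_mx mul_mx_row !zero' ?row_mx0 // => i.
  by rewrite frobenius_conjq zero expr0n -[#|F| == 0]negbK -lt0n (cardD1 0).
(* The ranks satisfy (3 - rank w1) + 2 <= 3, which is impossible as [w1] has rank at most 1. *)
rewrite mxrank_map mxrank_tr (eqP (free_u : \rank _ == _)) mxrank_ker mxrank_tr.
by have := rank_leq_row w1; case: (\rank w1) => [|[|]].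
Qed.

Lemma imaginary_pair_disc (a : 'M[F]_3) :
  imaginary_pair iota (quadform a) -> disc a = 0.
Proof.
move=> /andP[_ /existsP[d /existsP[u /andP[_ /eqP]]]].
rewrite map_quadform => /quadform_factor e; apply: (fmorph_inj iota).
by rewrite rmorph0 -map_disc -disc_upper e discZ disc_fold_mul mulr0.
Qed.

End Imaginary.

(** * Hyperplanes as point sets, and those through a line of the orbit *)

Section Hyperplanes.

Variable F : finFieldType.
Implicit Types (a b A M : 'M[F]_3) (L : {set {set 'M[F]_3}}).

Lemma point_hyperplane a M : M^T = M -> M != 0 ->
  (point M \in hyperplane a) = (pairing a M == 0).
Proof.
move=> sM M0; rewrite inE; apply/andP/idP => [[_ /forall_inP aM]|aM].
  by apply: aM; apply/imsetP; exists 1; rewrite ?inE ?oner_neq0 ?scale1r.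
split; first by apply/imsetP; exists M; rewrite // inE sM eqxx.
apply/forall_inP => _ /imsetP[c _ ->].
have -> : \sum_(i < 3) \sum_(j < 3 | (i <= j)%N) a i j * (c *: M) i j = c * pairing a M.
  by rewrite /pairing !sum_upper !mxE; ring.
by rewrite (eqP aM) mulr0.
Qed.

Lemma eq_hyperplane a b : upper a = upper b -> hyperplane a = hyperplane b.
Proof.
move=> e; apply/setP => P; rewrite !inE; congr (_ && _).
apply: eq_forallb => M; congr (_ ==> (_ == _)).
by rewrite -/(pairing a M) -/(pairing b M) -pairing_upper e pairing_upper.
Qed.

Lemma hyperplaneZ c a : c != 0 -> hyperplane (c *: a) = hyperplane a.
Proof.
move=> c0; apply/setP => P; rewrite !inE; congr (_ && _).
apply: eq_forallb => M; congr (_ ==> _).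
by rewrite -/(pairing (c *: a) M) pairingZ mulf_eq0 (negPf c0).
Qed.

(** Two linear functionals with the same zeros are proportional. Fix [M0] off the hyperplane; each
    symmetric [M] minus a suitable multiple of [M0] is a zero of [a], hence of [b]. *)
Lemma hyperplane_inj a b : upper a != 0 -> hyperplane a = hyperplane b ->
  exists2 c, c != 0 & upper b = c *: upper a.
Proof.
move=> a0 e.
have pairing0 c : pairing c 0 = 0 :> F by rewrite /pairing !sum_upper !mxE; ring.
have zeros M : M^T = M -> (pairing a M == 0) = (pairing b M == 0).
  move=> sM; have [->|M0] := eqVneq M 0; first by rewrite !pairing0.
  by rewrite -!point_hyperplane // e.
have [M0 /andP[/eqP sM0 aM0]] : exists M, (M^T == M) && (pairing a M != 0).
  apply/existsP; apply: contra_neqT a0 => /existsPn aM.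
  rewrite -(@upper0 F); apply: pairing_inj => M sM.
  have := aM M; rewrite sM eqxx /= negbK => /eqP ->.
  by rewrite /pairing !sum_upper !mxE; ring.
have bM0 : pairing b M0 != 0 by rewrite -zeros.
exists (pairing b M0 / pairing a M0); first by rewrite mulf_neq0 ?invr_neq0.
rewrite -upperZ; apply: pairing_inj => M sM; rewrite pairingZ.
have pairing_comb c s : pairing c (M - s *: M0) = pairing c M - s * pairing c M0.
  by rewrite /pairing !sum_upper !mxE; ring.
have : pairing b (M - (pairing a M / pairing a M0) *: M0) == 0.
  rewrite -zeros; last by rewrite linearB linearZ /= sM sM0.
  by rewrite pairing_comb mulfVK // subrr.
by rewrite pairing_comb subr_eq0 => /eqP ->; ring.
Qed.

Lemma act_point A M : [set A *m N *m A^T | N in point M] = point (A *m M *m A^T).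
Proof.
rewrite /point -imset_comp; apply: eq_imset => c /=.
by rewrite -scalemxAr -scalemxAl.
Qed.

(** By duality this is the condition that the substituted form pair to zero with the representative
    line, that is, with its two points (x, y) = (1, 0) and (0, 1). *)
Lemma actK_o83_subset A a : A \in unitmx ->
  (actK A (o83_line F) \subset hyperplane a) =
  (subst A a 0 0 == 0) && (subst A a 1 2%:R == 0).
Proof.
move=> A_unit.
have sym x y : (o83_mx x y)^T = o83_mx x y :> 'M[F]_3.
  by apply/matrixP => i j; rewrite !mxE andbC addnC.
have pairing_o83 x y : pairing (subst A a) (o83_mx x y) =
    subst A a 0 0 * x + subst A a 1 2%:R * y.
  by rewrite /pairing !sum_upper ![o83_mx _ _ _ _]mxE /=; ring.
have mem x y : (x, y) != (0, 0) :> F * F ->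
    (point (A *m o83_mx x y *m A^T) \in hyperplane a) =
    (subst A a 0 0 * x + subst A a 1 2%:R * y == 0).
  move=> xy0; rewrite point_hyperplane ?congr_sym -?pairing_subst ?pairing_o83 //.
  apply: contra_neq xy0 => e0.
  have /matrixP o0 : o83_mx x y = 0.
    have /(congr1 (fun N => invmx A *m N *m (invmx A)^T)) := e0.
    by rewrite -!mulmxA -trmx_mul mulVmx // trmx1 mulmx1 mulmxA mulVmx // mul1mx mul0mx mulmx0.
  by have := o0 0 0; have := o0 1 2%:R; rewrite !mxE /= => -> ->.
apply/subsetP/andP => [sub|[/eqP b00 /eqP b12] _ /imsetP[_ /imsetP[[x y] xy0 ->] ->]].
  have zero x y : (x, y) != (0, 0) :> F * F ->
      subst A a 0 0 * x + subst A a 1 2%:R * y == 0.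
    move=> xy0; rewrite -mem //; apply: sub.
    apply/imsetP; exists (point (o83_mx x y)); last by rewrite act_point.
    by apply/imsetP; exists (x, y); rewrite ?inE.
  have := zero 1 0; have := zero 0 1.
  rewrite !mulr0 !mulr1 add0r addr0 !xpair_eqE oner_eq0 eqxx andbF.
  by move=> -> // ->.
rewrite act_point mem //; last by move: xy0; rewrite inE.
by rewrite b00 b12 !mul0r addr0.
Qed.

Lemma card_fibers (T U : finType) (f : T -> U) (D : {set T}) k :
  (forall x, x \in D -> #|[set y in D | f y == f x]| = k) ->
  #|D| = (#|f @: D| * k)%N.
Proof.
move=> card_k; rewrite -sum1_card (partition_big_imset f) /=.
rewrite -sum_nat_const; apply: eq_bigr => _ /imsetP[x Dx ->].
by rewrite -(card_k x Dx) -sum1_card; apply: eq_bigl => y; rewrite inE.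
Qed.

(* Substituting A moves L to the representative line, whose hyperplanes are the
   forms b with b 0 0 = b 1 2 = 0; each of them has #|F| - 1 upper
   triangular coefficient matrices. *)
Lemma card_hyperplanes_o83 (Q : pred 'M[F]_3) L :
    (forall a, Q a -> upper a != 0) ->
    (forall A a, A \in unitmx -> Q a -> Q (subst A a)) ->
    (forall (c : F) a, c != 0 -> Q a -> Q (c *: a)) ->
    L \in o83 F ->
  (#|[set H in [set hyperplane a | a : 'M[F]_3 & Q a] | L \subset H]| * #|F|.-1)%N =
  #|[set b | [&& Q b, upper b == b, b 0 0 == 0 & b 1 2%:R == 0]]|.
Proof.
move=> Q_neq0 Q_subst QZ /imsetP[A]; rewrite inE => A_unit ->.
set S := [set b | Q b && _].
have V_unit : invmx A \in unitmx by rewrite unitmx_inv.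
have upper_S b : b \in S -> upper b = b by rewrite inE => /and4P[_ /eqP].
have Q_S b : b \in S -> Q b by rewrite inE => /andP[].
have substVK b : b \in S -> subst A (subst (invmx A) b) = b.
  by move=> Sb; rewrite substM mulVmx // subst1 upper_S.
pose f b := hyperplane (subst (invmx A) b).
(* The hyperplanes to be counted are the image of [S] under [f], which undoes the substitution of
   [A]. *)
have -> : [set H in [set hyperplane a | a : 'M[F]_3 & Q a]
              | actK A (o83_line F) \subset H] = f @: S.
  apply/setP => H; rewrite inE; apply/andP/imsetP => [[/imsetP[a]]|[b Sb ->]].
    rewrite inE => Qa -> ; rewrite actK_o83_subset // => /andP[a00 a12].
    exists (subst A a); first by rewrite inE Q_subst // upper_subst eqxx a00.
    by apply: eq_hyperplane; rewrite upper_subst substM mulmxV // subst1.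
  split.
    by apply/imsetP; exists (subst (invmx A) b); rewrite // inE Q_subst // Q_S.
  rewrite actK_o83_subset // substVK //.
  by move: Sb; rewrite inE => /and4P[_ _ -> ->].
rewrite [RHS](card_fibers (f := f) (k := #|F|.-1)) // => b Sb.
have b0 : b != 0 by rewrite -(upper_S b) // Q_neq0 // Q_S.
(* The fibre of [f] through [b] consists of the nonzero multiples of [b]. *)
have -> : [set y in S | f y == f b] = [set c *: b | c in [set~ 0 : F]].
  apply/setP => y; rewrite inE; apply/andP/imsetP => [[Sy /eqP/esym/hyperplane_inj fy]|[c]].
    have [|c c0] := fy.
      by rewrite upper_subst subst_neq0 // Q_neq0 // Q_S.
    rewrite !upper_subst -substZ => /(congr1 (subst A)).
    rewrite substVK // substM mulVmx // subst1 upperZ upper_S // => ->.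
    by exists c; rewrite // !inE.
  rewrite !inE => c0 ->; split.
    have Qb := Q_S _ Sb; move: Sb; rewrite inE => /and4P[_ /eqP ub b00 b12].
    by rewrite QZ //= upperZ ub eqxx !mxE (eqP b00) (eqP b12) mulr0 eqxx.
  by rewrite /f substZ hyperplaneZ.
rewrite card_imset; first by rewrite cardsC1.
move=> c d /eqP; rewrite -subr_eq0 -scalerBl scaler_eq0 (negPf b0) orbF subr_eq0.
by move/eqP.
Qed.

End Hyperplanes.

(** * Counting the forms of each type in characteristic 2 *)

Section Counting.

Variable F : finFieldType.
Hypothesis even_F : ~~ odd #|F|.

Let twoF : 2%:R = 0 :> F.
Proof.
have: (-1) ^+ #|F| = -1 :> F := expf_card _.
rewrite -signr_odd (negPf even_F) expr0 => e1.
by rewrite mulr2n {1}e1 addNr.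
Qed.

Let pchar2F : 2 \in [pchar F].
Proof. by rewrite inE /= twoF. Qed.

Let sqrtF (z : F) : exists s, s ^+ 2 = z.
Proof.
by exists (z ^+ #|F|./2); rewrite -exprM muln2 even_halfK // expf_card.
Qed.

(** The quadruple t = ((x, y), (z, w)) stands for x X0X1 + y X0X2 + z X1^2 + w X2^2. *)
Definition coef_mx (t : (F * F) * (F * F)) : 'M[F]_3 := \matrix_(i, j)
  (if (i == 0) && (j == 1) then t.1.1
   else if (i == 0) && (j == 2%:R) then t.1.2
   else if (i == 1) && (j == 1) then t.2.1
   else if (i == 2%:R) && (j == 2%:R) then t.2.2 else 0).

Lemma upper_coef_mx t : upper (coef_mx t) = coef_mx t.
Proof. by apply/matrixP => i j; rewrite !mxE; elim/ord3P: i; elim/ord3P: j. Qed.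

Lemma coef_mx_onto (b : 'M[F]_3) : upper b = b -> b 0 0 = 0 -> b 1 2%:R = 0 ->
  exists t, b = coef_mx t.
Proof.
move=> ub b00 b12; exists ((b 0 1, b 0 2%:R), (b 1 1, b 2%:R 2%:R)).
rewrite -{1}ub; apply/matrixP => i j; rewrite !mxE.
by elim/ord3P: i; elim/ord3P: j.
Qed.

Lemma card_coef_mx (Q : pred 'M[F]_3) :
  #|[set b | [&& Q b, upper b == b, b 0 0 == 0 & b 1 2%:R == 0]]| =
  #|[set t | Q (coef_mx t)]|.
Proof.
have coef_mx_inj : injective coef_mx.
  move=> [[x y] [z w]] [[x' y'] [z' w']] /matrixP e.
  move: (e 0 1) (e 0 2%:R) (e 1 1) (e 2%:R 2%:R); rewrite !mxE /=.
  by move=> -> -> -> ->.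
rewrite -(card_imset _ coef_mx_inj); apply: eq_card => b; rewrite inE.
apply/and4P/imsetP => [[Qb /eqP ub /eqP b00 /eqP b12]|[t]].
  by have [t e] := coef_mx_onto ub b00 b12; exists t; rewrite // inE -e.
by rewrite inE => Qt ->; rewrite upper_coef_mx Qt !mxE /= !eqxx.
Qed.

Lemma coef_mx0 : coef_mx ((0, 0), (0, 0)) = 0.
Proof. by apply/matrixP => i j; rewrite !mxE; do 4?[case: ifP => _]. Qed.

(** The mixed coefficients of a square are doubles, hence 0. Conversely every element of [F] is a
    square, so a form z X1^2 + w X2^2 is the square of a linear form. *)
Lemma double_line_coef_mx t :
  double_line (quadform (coef_mx t)) = (t.1 == (0, 0)) && (t.2 != (0, 0)).
Proof.
case: t => [[x y] [z w]] /=; apply/double_lineP/andP.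
  rewrite upper_coef_mx => -[t0 [c [u /matrixP e]]].
  have x0 : x = 0.
    by have := e 0 1; rewrite !mxE /= !big_ord1 !mxE [_ * u 0 0]mulrC addrr_pchar2 ?mulr0.
  have y0 : y = 0.
    by have := e 0 2%:R; rewrite !mxE /= !big_ord1 !mxE [_ * u 0 0]mulrC addrr_pchar2 ?mulr0.
  subst x y; split=> //; apply: contra_neq t0 => -[-> ->].
  exact: coef_mx0.
rewrite upper_coef_mx => -[/eqP[-> ->] zw0]; split.
  apply: contra_neq zw0 => /matrixP e.
  by move: (e 1 1) (e 2%:R 2%:R); rewrite !mxE /= => -> ->.
have [s sz] := sqrtF z; have [r rw] := sqrtF w.
exists 1, (\row_j (if j == 0 then 0 else if j == 1 then s else r)).
apply/matrixP => i j; rewrite !mxE !big_ord1 !mxE -sz -rw.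
elim/ord3P: i; elim/ord3P: j => /=; try ring.
by rewrite [r * s]mulrC addrr_pchar2 ?mulr0.
Qed.

Lemma disc_coef_mx t :
  (disc (coef_mx t) != 0) = (t.2.1 * t.1.2 ^+ 2 != t.2.2 * t.1.1 ^+ 2).
Proof.
rewrite -[in RHS]subr_eq0 -[t.2.1 * _](oppr_pchar2 pchar2F); congr (_ != 0).
by rewrite /disc !mxE /=; ring.
Qed.

Lemma proportional_squares (x y z w : F) : (x, y) != (0, 0) ->
  z * y ^+ 2 = w * x ^+ 2 -> exists s, s * x ^+ 2 = z /\ s * y ^+ 2 = w.
Proof.
move=> xy0 e; have [x0|x0] := eqVneq x 0.
  have y0 : y != 0 by apply: contra_neq xy0 => ->; rewrite x0.
  exists (w / y ^+ 2); rewrite mulfVK ?expf_neq0 // x0; split=> //.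
  move: e => /eqP; rewrite x0 expr0n !mulr0 mulf_eq0 expf_eq0 (negPf y0) orbF.
  by move/eqP.
by exists (z / x ^+ 2); rewrite mulfVK ?expf_neq0 // mulrAC e mulfK ?expf_neq0.
Qed.

Lemma real_pair_coef_mx t : real_pair (quadform (coef_mx t)) =
  (t.1 != (0, 0)) && (t.2.1 * t.1.2 ^+ 2 == t.2.2 * t.1.1 ^+ 2).
Proof.
apply/idP/andP => [real_t|[]].
  split; last by rewrite -[_ == _]negbK -disc_coef_mx (real_pair_disc real_t) eqxx.
  have [u [v [/nonpropP[i [j ne_ij]]]]] := real_pairP _ real_t.
  rewrite upper_coef_mx => /matrixP e.
  (* If x = y = 0, all mixed coefficients u_k v_l + u_l v_k vanish; in characteristic 2 these are
     the minors of u and v. *)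
  apply: contra_neq ne_ij; case: t e {real_t} => [[x y] [z w]] /= e [x0 y0].
  subst x y.
  have swap (k l : 'I_3) : (k < l)%N -> u 0 k * v 0 l = u 0 l * v 0 k.
    move=> kl; apply/eqP; rewrite -subr_eq0 (oppr_pchar2 pchar2F); apply/eqP.
    have := e k l; rewrite !mxE kl !big_ord1 !mxE => <-.
    by elim/ord3P: k kl; elim/ord3P: l.
  by case: (ltngtP i j) => [|/swap|/val_inj->] //; exact: swap.
case: t => [[x y] [z w]] /= xy0 /eqP e.
have [s [sx sy]] := proportional_squares xy0 e.
apply/real_pairP.
(* The factors are x X1 + y X2 and X0 + s (x X1 + y X2). The X1X2 coefficient of their product is
   2sxy = 0. *)
exists (\row_j (if j == 0 then 0 else if j == 1 then x else y)).
exists (\row_j (if j == 0 then 1 else if j == 1 then s * x else s * y)).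
split; last first.
  rewrite upper_coef_mx; apply/matrixP => i j; rewrite !mxE !big_ord1 !mxE -sx -sy.
  elim/ord3P: i; elim/ord3P: j => /=; try ring.
  by rewrite -[LHS](addrr_pchar2 pchar2F (s * x * y)); ring.
apply/nonpropP; have [x0|x0] := eqVneq x 0.
  exists 2%:R, 0; rewrite !mxE /= mulr1 mul0r.
  by apply: contra_neq xy0 => ->; rewrite x0.
by exists 1, 0; rewrite !mxE /= mulr1 mul0r.
Qed.

Lemma card_nonzero_pairs : #|[set~ (0, 0) : F * F]| = (#|F| ^ 2).-1.
Proof. by rewrite cardsC1 card_prod. Qed.

Lemma card_double_line_coef_mx :
  #|[set t | double_line (quadform (coef_mx t))]| = (#|F| ^ 2).-1.
Proof.
rewrite -card_nonzero_pairs -[RHS]mul1n -(cards1 (0 : F, 0 : F)) -cardsX.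
by apply: eq_card => t; rewrite !inE double_line_coef_mx.
Qed.

Lemma card_real_pair_coef_mx :
  #|[set t | real_pair (quadform (coef_mx t))]| = ((#|F| ^ 2).-1 * #|F|)%N.
Proof.
(* Real pairs are parametrised by a nonzero (x, y) and the scalar s with (z, w) = s (x^2, y^2); s is
   determined since x or y is nonzero. *)
pose g (r : (F * F) * F) := (r.1, (r.2 * r.1.1 ^+ 2, r.2 * r.1.2 ^+ 2)).
rewrite -card_nonzero_pairs -[X in (_ * X)%N]cardsT -cardsX.
rewrite -(card_in_imset (f := g)); last first.
  move=> [[x y] s] [[x' y'] s'] /setXP[xy0 _] _ [<- <-]; move: xy0; rewrite !inE /=.
  have [->|x0] := eqVneq x 0; last first.
    by move=> _ /(mulIf (expf_neq0 2 x0)) -> _.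
  have [->|y0] := eqVneq y 0; first by rewrite eqxx.
  by move=> _ _ /(mulIf (expf_neq0 2 y0)) ->.
apply: eq_card => -[[x y] [z w]]; rewrite inE real_pair_coef_mx /=.
apply/andP/imsetP => [[xy0 /eqP e]|[[[x' y'] s]]].
  have [s [<- <-]] := proportional_squares xy0 e.
  by exists ((x, y), s); rewrite ?inE ?xy0.
rewrite !inE /= andbT => xy0 [-> -> -> ->]; split=> //.
by apply/eqP; ring.
Qed.

(** The quadruples of zero discriminant split into those with x = y = 0, the zero form among them,
    and the real pairs. The additive shape avoids truncated subtraction. *)
Lemma card_disc_coef_mx : (#|[set t | disc (coef_mx t) != 0%R]| +
  (#|F| ^ 2 + (#|F| ^ 2).-1 * #|F|) = #|F| ^ 4)%N.
Proof.
have <- : #|{: (F * F) * (F * F)}| = (#|F| ^ 4)%N by rewrite !card_prod; ring.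
rewrite -(cardsC [set t | disc (coef_mx t) != 0%R]); congr (_ + _)%N.
rewrite -card_real_pair_coef_mx.
have <- : #|setX [set (0 : F, 0 : F)] [set: F * F]| = (#|F| ^ 2)%N.
  by rewrite cardsX cards1 mul1n cardsT card_prod.
rewrite -cardsUI.
set I := _ :&: _; have -> : I = set0.
  apply/setP => t; rewrite !inE real_pair_coef_mx.
  by case: eqP; rewrite ?andbF.
rewrite cards0 addn0; apply: eq_card => -[[x y] [z w]].
rewrite !inE disc_coef_mx real_pair_coef_mx negbK andbT /=.
by have [[-> ->]|] := eqVneq (x, y) (0, 0); rewrite ?expr0n ?mulr0 ?eqxx.
Qed.

End Counting.

(** * Assembling the four entries of the distribution *)

Theorem lemma4p6 (q : nat) (F E : finFieldType) (iota : {rmorphism F -> E})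
    (cardF : #|F| = q) (q_even : ~~ odd q) (cardE : #|E| = (q ^ 2)%N)
    (L : {set {set 'M[F]_3}}) (L_o83 : L \in o83 F) :
  OD4 iota L = [:: (q + 1)%N; (q ^ 2 + q)%N; 0%N; (q ^ 3 - q)%N].
Proof.
have q_gt1 : (1 < q)%N by rewrite -cardF finNzRing_gt1.
have even_F : ~~ odd #|F| by rewrite cardF.
have cancel m n : (m * #|F|.-1 = n * #|F|.-1 -> m = n)%N.
  move=> /eqP; rewrite eqn_pmul2r => [/eqP //|].
  by rewrite cardF -subn1 subn_gt0.
have H1_card : #|[set H in H1 F | L \subset H]| = (q + 1)%N.
  have dbl_neq0 (a : 'M[F]_3) : double_line (quadform a) -> upper a != 0.
    by move=> /double_lineP[].
  apply: cancel; rewrite (card_hyperplanes_o83 dbl_neq0 (@double_line_subst F)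
    (@double_lineZ F) L_o83).
  by rewrite card_coef_mx card_double_line_coef_mx // cardF; nia.
have H2r_card : #|[set H in H2r F | L \subset H]| = (q ^ 2 + q)%N.
  apply: cancel; rewrite (card_hyperplanes_o83 (@real_pair_neq0 F)
    (@real_pair_subst F) (@real_pairZ F) L_o83).
  by rewrite card_coef_mx card_real_pair_coef_mx // cardF; nia.
have H3_card : #|[set H in H3 F | L \subset H]| = (q ^ 3 - q)%N.
  have disc_subst_neq0 (A a : 'M[F]_3) :
      A \in unitmx -> disc a != 0 -> disc (subst A a) != 0.
    by rewrite unitmxE unitfE disc_subst => A0 a0; rewrite mulf_neq0 ?expf_neq0.
  have discZ_neq0 (c : F) (a : 'M[F]_3) : c != 0 -> disc a != 0 -> disc (c *: a) != 0.
    by move=> c0 a0; rewrite discZ mulf_neq0 ?expf_neq0.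
  apply: cancel; rewrite (card_hyperplanes_o83 (@disc_neq0 F) disc_subst_neq0
    discZ_neq0 L_o83) card_coef_mx.
  by have := card_disc_coef_mx even_F; rewrite cardF; move: #|_| => h; nia.
have H2i_card : #|[set H in H2i iota | L \subset H]| = 0%N.
  apply/eqP; rewrite cards_eq0; apply/eqP/setP => H; rewrite !inE.
  apply/andP => -[/imsetP[a]]; rewrite inE => imag_a ->.
  have /imsetP[A] := L_o83; rewrite inE => A_unit ->.
  rewrite actK_o83_subset // => /andP[/eqP b00 /eqP b12].
  have [t tE] : exists t, subst A a = coef_mx t.
    by apply: coef_mx_onto => //; apply: upper_subst.
  (* A rational factorisation of the substituted form would pull back along the inverse of [A] to
     one of the imaginary pair itself. *)
  have back c (u v : 'rV[F]_3) : subst A a = c *: fold (u^T *m v) -> False.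
    rewrite -upper_subst => /(subst_factor (invmx A)).
    rewrite substM mulmxV // subst1 => /eqP; apply/negP.
    exact: imaginary_pair_not_split imag_a.
  have disc_b : disc (subst A a) = 0.
    by rewrite disc_subst (imaginary_pair_disc imag_a) mulr0.
  (* With zero discriminant, the substituted form is zero, a double line or a real pair; each of
     these factors over [F]. *)
  have [t1|t1] := eqVneq t.1 (0, 0).
    have [t2|t2] := eqVneq t.2 (0, 0).
      apply: (back 0 0 0); rewrite scale0r tE -(coef_mx0 F).
      by case: (t) t1 t2 => ? ? /= -> ->.
    have /double_lineP[_ [c [u]]] : double_line (quadform (subst A a)).
      by rewrite tE double_line_coef_mx // t1 t2 eqxx.
    by rewrite upper_subst => /back.
  have /real_pairP[u [v [_]]] : real_pair (quadform (subst A a)).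
    rewrite tE real_pair_coef_mx // t1 -[_ == _]negbK -disc_coef_mx // -tE disc_b.
    by rewrite eqxx.
  by rewrite upper_subst -[fold _]scale1r => /back.
by rewrite /OD4 /= H1_card H2r_card H2i_card H3_card.
Qed.
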